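(* Let $G=(V,E)$ be a finite undirected simple unweighted $D$-regular graph with $N=|V|$, and let $\sigma:E^{or}\to H$ be a signature, where $H=O(d)$ or $H=U(d)$. Assume that $G$ with the signature $\sigma$ satisfies $CD^\sigma(0,\infty)$. Then for each natural number $1\le k\le N$, $$\lambda_{kd}^\sigma\le 16D(kd)^2\log(2kd)\,(h_k^\sigma)^2 .$$
   Context: Let $D\ge 1$, $d\ge 1$. Put $\mathbb{K}=\mathbb{R}$ if $H=O(d)$ and $\mathbb{K}=\mathbb{C}$ if $H=U(d)$. Write $x\sim y$ if $\{x,y\}\in E$, and $E^{or}=\{(x,y),(y,x)\mid \{x,y\}\in E\}$. A signature is a map $\sigma:E^{or}\to H$ with $\sigma_{yx}=\sigma_{xy}^{-1}$. Laplacians: for $u:V\to\mathbb{K}$, $\Delta u(x)=\frac1D\sum_{y\sim x}(u(y)-u(x))$; for $f:V\to\mathbb{K}^d$, $\Delta^\sigma f(x)=\frac1D\sum_{y\sim x}(\sigma_{xy}f(y)-f(x))$. The eigenvalues of the connection Laplacian are the eigenvalues of $-\Delta^\sigma$, listed with multiplicity as $0\le\lambda_1^\sigma\le\lambda_2^\sigma\le\cdots\le\lambda_{Nd}^\sigma\le 2$. Curvature: for $f,g:V\to\mathbb{K}^d$ define the $\mathbb{K}$-valued functions $2\Gamma^\sigma(f,g)=\Delta(f^T\overline g)-f^T(\overline{\Delta^\sigma g})-(\Delta^\sigma f)^T\overline g$ and $2\Gamma_2^\sigma(f,g)=\Delta\Gamma^\sigma(f,g)-\Gamma^\sigma(f,\Delta^\sigma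 g)-\Gamma^\sigma(\Delta^\sigma f,g)$, with $\Gamma^\sigma(f)=\Gamma^\sigma(f,f)$, $\Gamma_2^\sigma(f)=\Gamma_2^\sigma(f,f)$. $CD^\sigma(K,\infty)$ means $\Gamma_2^\sigma(f)(x)\ge K\,\Gamma^\sigma(f)(x)$ for all $f:V\to\mathbb{K}^d$ and all $x\in V$. Cheeger constants: for a $(d\times d)$-matrix $A$ with columns $A^1,\dots,A^d$, $|A|_{2,1}:=\frac1d\sum_{i=1}^d|A^i|$ where $|\cdot|$ is the Euclidean (Hermitian) norm. For $\emptyset\ne S\subseteq V$ let $E_S$ be the edge set of the induced subgraph of $S$, and define the frustration index $\iota^\sigma(S)=\min_{\tau:S\to H}\sum_{\{x,y\}\in E_S}|\sigma_{xy}\tau(y)-\tau(x)|_{2,1}$ (each summand is independent of the orientation of the edge). Let $|E(S,V\setminus S)|$ be the number of edges between $S$ and $V\setminus S$, and $\phi^\sigma(S)=\frac{\iota^\sigma(S)+|E(S,V\setminus S)|}{D\,|S|}$. Then $h_k^\sigma=\min_{\{S_i\}_{i=1}^k}\max_{1\le i\le k}\phi^\sigma(S_i)$, the minimum being over all families of $k$ nonempty pairwise disjoint subsets of $V$. *)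

(* Defs.v *)
From HB Require Import structures.
From mathcomp Require Import all_boot all_order all_algebra.
From mathcomp Require Import finmap.
From mathcomp Require Import all_classical all_reals all_analysis.
From mathcomp Require Import complex.

Set Implicit Arguments.
Unset Strict Implicit.
Unset Printing Implicit Defensive.

Import Order.TTheory GRing.Theory Num.Theory.

Local Open Scope ring_scope.

Variant group_family := Orthogonal | Unitary.

(* The field K: the reals for O(d), the complex numbers for U(d).  The order of
   R[i] is partial: z <= w iff Im z = Im w and Re z <= Re w. *)
Definition base_field (R : realType) (H : group_family) : numFieldType :=
  match H with Orthogonal => R | Unitary => R[i] end.

Definition of_real (R : realType) (H : group_family) : R -> base_field R H :=
  match H return R -> base_field R H with
  | Orthogonal => fun t => t
  | Unitary => fun t => real_complex R t
  end.

Definition field_conj (R : realType) (H : group_family) :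
    base_field R H -> base_field R H :=
  match H return base_field R H -> base_field R H with
  | Orthogonal => fun z => z
  | Unitary => fun z => @conjc R z
  end.

(* The modulus, valued in R (the norm of R[i] is valued in R[i]). *)
Definition modulus (R : realType) (H : group_family) : base_field R H -> R :=
  match H return base_field R H -> R with
  | Orthogonal => fun z => `|z|
  | Unitary => fun z => ComplexField.Normc.normc z
  end.

(* O(d), respectively U(d). *)
Definition in_group (R : realType) (H : group_family) (d : nat)
    (A : 'M[base_field R H]_d) : bool :=
  (map_mx (@field_conj R H) A)^T *m A == 1%:M.

Definition simple_graph (V : finType) (e : rel V) : Prop :=
  symmetric e /\ irreflexive e.

Definition regular (V : finType) (e : rel V) (D : nat) : Prop :=
  forall x, #|[pred y | e x y]| = D.

(* A signature is a total function on V * V; its values on non-adjacent pairs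
   are arbitrary and never used. *)
Definition signature (R : realType) (H : group_family) (d : nat)
    (V : finType) (e : rel V) (sigma : V -> V -> 'M[base_field R H]_d) : Prop :=
  forall x y, e x y -> in_group (sigma x y) /\ sigma y x = invmx (sigma x y).

Section Laplacians.
Variables (R : realType) (H : group_family) (d : nat).
Variables (V : finType) (e : rel V) (D : nat).
Variable sigma : V -> V -> 'M[base_field R H]_d.

Local Notation K := (base_field R H).
Local Notation vfun := {ffun V -> 'cV[K]_d}.

Definition laplacian (u : V -> K) (x : V) : K :=
  D%:R^-1 * \sum_(y | e x y) (u y - u x).

Definition conn_laplacian (f : vfun) : vfun :=
  [ffun x => D%:R^-1 *: \sum_(y | e x y) (sigma x y *m f y - f x)].

Lemma conn_laplacian_is_linear : linear conn_laplacian.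
Proof.
move=> a f g; apply/ffunP => x; rewrite !ffunE.
rewrite scalerA mulrC -scalerA -scalerDr; congr (_ *: _).
rewrite scaler_sumr -big_split /=; apply: eq_bigr => y _.
by rewrite !ffunE mulmxDr -scalemxAr scalerBr opprD addrACA.
Qed.

HB.instance Definition _ :=
  GRing.isLinear.Build K vfun vfun _ conn_laplacian conn_laplacian_is_linear.

(* The pointwise product f^T \bar g. *)
Definition pairing (f g : vfun) (x : V) : K :=
  ((f x)^T *m map_mx (@field_conj R H) (g x)) ord0 ord0.

Definition Gamma (f g : vfun) (x : V) : K :=
  2^-1 * (laplacian (pairing f g) x
          - pairing f (conn_laplacian g) x - pairing (conn_laplacian f) g x).

Definition Gamma2 (f g : vfun) (x : V) : K :=
  2^-1 * (laplacian (Gamma f g) x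
          - Gamma f (conn_laplacian g) x - Gamma (conn_laplacian f) g x).

(* CD^sigma(kappa, oo).  Gamma f f x and Gamma2 f f x are real, so the partial
   order of K compares them as real numbers. *)
Definition CD (kappa : R) : Prop :=
  forall (f : vfun) (x : V),
    of_real H kappa * Gamma f f x <= Gamma2 f f x.

Definition neg_conn_laplacian : 'End(vfun) := - linfun conn_laplacian.

(* The eigenvalues of the self-adjoint operator -Delta^sigma, all of them real,
   in nondecreasing order, each repeated as many times as the dimension of its
   eigenspace. *)
Definition spectrum : seq R :=
  sort <=%R (flatten
    [seq nseq (\dim (passmx.leigenspace neg_conn_laplacian (of_real H t))) t
    | t <- fset_set
             [set t : R | passmx.leigenvalue neg_conn_laplacian (of_real H t)]%classic]).

(* The k-th eigenvalue, counted from k = 1. *)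
Definition lambda (k : nat) : R := nth 0 spectrum k.-1.

End Laplacians.

Section Cheeger.
Variables (R : realType) (H : group_family) (d : nat).
Variables (V : finType) (e : rel V) (D : nat).
Variable sigma : V -> V -> 'M[base_field R H]_d.

Local Notation K := (base_field R H).

Definition enorm (v : 'cV[K]_d) : R :=
  Num.sqrt (\sum_(i < d) modulus (v i ord0) ^+ 2).

Definition norm21 (A : 'M[K]_d) : R :=
  d%:R^-1 * \sum_(i < d) enorm (col i A).

(* Each edge {x, y} of the subgraph induced by S is counted once, in the
   orientation that is increasing for the enumeration of V. *)
Definition frustration_of (S : {set V}) (tau : V -> 'M[K]_d) : R :=
  \sum_(p : V * V | [&& p.1 \in S, p.2 \in S, e p.1 p.2
                      & (enum_rank p.1 < enum_rank p.2)%N])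
    norm21 (sigma p.1 p.2 *m tau p.2 - tau p.1).

(* The infimum is a minimum, as H is compact.  Only the values of tau on S
   matter. *)
Definition frustration (S : {set V}) : R :=
  inf [set frustration_of S tau
      | tau in [set tau : V -> 'M[K]_d
               | forall x, x \in S -> in_group (tau x)]]%classic.

(* An edge between S and its complement is encoded by the pair of its endpoint
   in S and its endpoint outside S. *)
Definition boundary (S : {set V}) : {set V * V} :=
  [set p | [&& p.1 \in S, p.2 \notin S & e p.1 p.2]].

Definition phi (S : {set V}) : R :=
  (frustration S + #|boundary S|%:R) / (D%:R * #|S|%:R).

Definition admissible (k : nat) (S : 'I_k -> {set V}) : Prop :=
  (forall i, (0 < #|S i|)%N) /\
  (forall i j, i != j -> [disjoint S i & S j]).

(* A minimum over finitely many families, nonempty for k <= #|V|; since phi is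
   nonnegative, the default value 0 does not affect the maximum for 0 < k. *)
Definition cheeger (k : nat) : R :=
  inf [set \big[Num.max/0]_(i < k) phi (S i)
      | S in [set S : 'I_k -> {set V} | admissible S]]%classic.

End Cheeger.

(* Main.v *)
From HB Require Import structures.
Require Import Defs.
From mathcomp Require Import all_boot all_order all_algebra.
From mathcomp Require Import finmap.
From mathcomp Require Import all_classical all_reals all_analysis.
From mathcomp Require Import complex spectral.
From mathcomp Require Import ring lra.

Set Implicit Arguments.
Unset Strict Implicit.
Unset Printing Implicit Defensive.

Import Order.TTheory GRing.Theory Num.Theory passmx.

Local Open Scope ring_scope.

(** The idea is that nonnegative curvature makes the heat flow of the
    connection Laplacian L smoothing, so that it hardly moves functions with a
    small total gradient, whereas the spectrum forces it to contract some
    combination of any k * d orthonormal functions.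

    The semigroup exp (s L) is replaced by n implicit Euler steps of length
    t = s / n, the powers of J = (1 - t L)^-1.  A step only requires the
    solution of a linear equation, and the maximum principle for 1 - t Delta
    takes the place of the positivity of the scalar semigroup.

    Smoothing.  For g = J f, expanding f = g - t L g in the squared length and
    in the energy Gamma gives
      (1 - t Delta) |g|^2 + 2 t Gamma(g) <= |f|^2,
      (1 - t Delta) Gamma(g) <= Gamma(f),
    the second by CD(0, oo).  Together they yield, by induction, that
    |J^n f|^2 + 2 n t Gamma(J^(n+1) f) <= sup |f|^2 (flow_bound): at time s the
    gradient of a function bounded by 1 is at most 1 / sqrt (2 s).  Summation by
    parts and the sum over the steps then bound <f, f - J^n f> by
    sqrt (2 s) + O(t) times the sum of sqrt (Gamma f) (flow_displacement).

    Test functions.  Let S_1, ..., S_k and gauges tau_i on S_i be nearly optimal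
    for the Cheeger constant h.  The columns of tau_i, extended by 0, are k * d
    orthogonal functions of squared norm |S_i| and of length at most 1.  The
    frustration index and the boundary of S_i bound their total gradients, on
    average over the columns, by sqrt (2 D) h |S_i| (sum_sqrt_energy_cut).  With
    m = k * d, the normalised family therefore loses at most 2 m sqrt (s D) h in
    total under the flow, up to an error that vanishes with t.

    Spectrum.  Since at most m - 1 eigenvalues lie below lambda_m, an
    orthonormal family of m functions keeps at most m - 1 + (1 + t lambda_m)^-n
    under J^n, by Bessel's inequality in an eigenbasis (flow_trace).

    Comparing the two, 1 - exp (- s lambda_m) <= 2 m sqrt (s D) h in the limit
    of small steps.  The choice s = 1 / (16 D m^2 h^2) makes the right-hand side
    1 / 2, so that s lambda_m <= ln 2 <= ln (2 m), which is the claim. *)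

(** * The scalar field and the Hermitian product on K^d *)

Section Scalars.
Variables (R : realType) (H : group_family).
Local Notation K := (base_field R H).
Local Notation conj := (@field_conj R H).
Local Notation rc := (@of_real R H).

Definition re : K -> R :=
  match H return base_field R H -> R with
  | Orthogonal => fun z => z
  | Unitary => fun z => complex.Re z
  end.

(** Both fields are embedded in R[i], where Hermitian matrices can be
    diagonalised. *)
Definition to_complex : K -> R[i] :=
  match H return base_field R H -> R[i] with
  | Orthogonal => fun z => real_complex R z
  | Unitary => fun z => z
  end.

Lemma field_conj_additive : zmod_morphism conj.
Proof. by rewrite /field_conj; case: H => x y //=; rewrite rmorphB. Qed.

Lemma field_conj_monoid : monoid_morphism conj.
Proof.
by rewrite /field_conj; case: H; split=> [|x y] //; rewrite ?rmorphM ?rmorph1.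
Qed.

HB.instance Definition _ :=
  GRing.isZmodMorphism.Build K K conj field_conj_additive.
HB.instance Definition _ :=
  GRing.isMonoidMorphism.Build K K conj field_conj_monoid.

Lemma of_real_additive : zmod_morphism rc.
Proof. by rewrite /of_real; case: H => x y //=; rewrite rmorphB. Qed.

Lemma of_real_monoid : monoid_morphism rc.
Proof.
by rewrite /of_real; case: H; split=> [|x y] //; rewrite ?rmorphM ?rmorph1.
Qed.

HB.instance Definition _ :=
  GRing.isZmodMorphism.Build R K rc of_real_additive.
HB.instance Definition _ :=
  GRing.isMonoidMorphism.Build R K rc of_real_monoid.

Lemma to_complex_additive : zmod_morphism to_complex.
Proof. by rewrite /to_complex; case: H => x y //=; rewrite rmorphB. Qed.

Lemma to_complex_monoid : monoid_morphism to_complex.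
Proof.
by rewrite /to_complex; case: H; split=> [|x y] //; rewrite ?rmorphM ?rmorph1.
Qed.

HB.instance Definition _ :=
  GRing.isZmodMorphism.Build K R[i] to_complex to_complex_additive.
HB.instance Definition _ :=
  GRing.isMonoidMorphism.Build K R[i] to_complex to_complex_monoid.

Lemma re_additive : zmod_morphism re.
Proof. by rewrite /re; case: H => x y //=; case: x y => [a b] [c d]. Qed.

HB.instance Definition _ :=
  GRing.isZmodMorphism.Build K R re re_additive.

Lemma field_conjK : involutive conj.
Proof. by rewrite /field_conj; case: H => //= x; rewrite conjcK. Qed.

Lemma field_conj_real a : conj (rc a) = rc a.
Proof. by rewrite /field_conj /of_real; case: H => //=; rewrite oppr0. Qed.

Lemma re_real a : re (rc a) = a.
Proof. by rewrite /re /of_real; case: H. Qed.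

Lemma reZ a z : re (rc a * z) = a * re z.
Proof.
by rewrite /re /of_real; case: H z => //= -[x y] /=; rewrite mul0r subr0.
Qed.

Lemma re_conj z : re (conj z) = re z.
Proof. by rewrite /re /field_conj; case: H z => //= -[]. Qed.

Lemma re_mul_conj (z : K) : re (z * conj z) = modulus z ^+ 2.
Proof.
rewrite /re /field_conj /modulus; case: H z => /= [z|[x y]] /=.
  by rewrite real_normK ?num_real.
by rewrite sqr_sqrtr ?addr_ge0 ?sqr_ge0 // mulrN opprK !expr2.
Qed.

Lemma modulus_eq0 (z : K) : (modulus z == 0) = (z == 0).
Proof.
rewrite /modulus; case: H z => /= z; first by rewrite normr_eq0.
apply/eqP/eqP => [|->]; first exact: ComplexField.Normc.eq0_normc.
exact: ComplexField.Normc.normc0.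
Qed.

Lemma re_ge0 z : 0 <= z -> 0 <= re z.
Proof. by rewrite /re; case: H z => //= z; rewrite lecE => /andP[]. Qed.

Lemma to_complex_conj z : to_complex (conj z) = (to_complex z)^*%C.
Proof.
by rewrite /to_complex /field_conj; case: H z => //= z; rewrite oppr0.
Qed.

Lemma to_complex_real a : to_complex (rc a) = a%:C%C.
Proof. by rewrite /to_complex /of_real; case: H. Qed.

Lemma Re_to_complex z : complex.Re (to_complex z) = re z.
Proof. by rewrite /to_complex /re; case: H z. Qed.

(** The value at a point of the pairing f^T \bar g.  Its real part makes K^d a
    Euclidean space over R, and the estimates of the heat flow take place there,
    so that they need no distinction of the two cases. *)
Definition cdot d (u v : 'cV[K]_d) : K :=
  (u^T *m map_mx conj v) ord0 ord0.

Definition dot d (u v : 'cV[K]_d) : R := re (cdot u v).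

Section Dot.
Variable d : nat.
Implicit Types (u v w : 'cV[K]_d) (A : 'M[K]_d).

Lemma cdotE u v : cdot u v = \sum_i u i ord0 * conj (v i ord0).
Proof. by rewrite /cdot mxE; apply: eq_bigr => i _; rewrite !mxE. Qed.

Lemma cdotBl u v w : cdot (u - v) w = cdot u w - cdot v w.
Proof. by rewrite /cdot linearB /= mulmxBl !mxE. Qed.

Lemma cdotBr u v w : cdot w (u - v) = cdot w u - cdot w v.
Proof. by rewrite /cdot map_mxB mulmxBr !mxE. Qed.

Lemma cdotZl a u v : cdot (a *: u) v = a * cdot u v.
Proof. by rewrite /cdot linearZ /= -scalemxAl mxE. Qed.

Lemma cdotZr a u v : cdot u (a *: v) = conj a * cdot u v.
Proof. by rewrite /cdot map_mxZ -scalemxAr mxE. Qed.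

Lemma cdot0l u : cdot 0 u = 0.
Proof. by rewrite /cdot trmx0 mul0mx mxE. Qed.

Lemma cdot0r u : cdot u 0 = 0.
Proof. by rewrite /cdot map_mx0 mulmx0 mxE. Qed.

Lemma cdotC u v : cdot u v = conj (cdot v u).
Proof.
rewrite !cdotE rmorph_sum; apply: eq_bigr => i _.
by rewrite rmorphM /= field_conjK mulrC.
Qed.

Lemma cdot_suml (I : finType) (P : pred I) (F : I -> 'cV[K]_d) v :
  cdot (\sum_(i | P i) F i) v = \sum_(i | P i) cdot (F i) v.
Proof.
rewrite /cdot linear_sum /= mulmx_suml summxE; exact: eq_bigr.
Qed.

Lemma cdot_mulmxl A u v :
  cdot (A *m u) v = cdot u (map_mx conj A^T *m v).
Proof.
rewrite /cdot trmx_mul map_mxM -map_mx_comp (map_mx_id _ A^T) ?mulmxA //.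
by move=> x; exact: field_conjK.
Qed.

Lemma dotBl u v w : dot (u - v) w = dot u w - dot v w.
Proof. by rewrite /dot cdotBl raddfB. Qed.

Lemma dotBr u v w : dot w (u - v) = dot w u - dot w v.
Proof. by rewrite /dot cdotBr raddfB. Qed.

Lemma dotZl a u v : dot (rc a *: u) v = a * dot u v.
Proof. by rewrite /dot cdotZl reZ. Qed.

Lemma dotC u v : dot u v = dot v u.
Proof. by rewrite /dot cdotC re_conj. Qed.

Lemma dotZr a u v : dot u (rc a *: v) = a * dot u v.
Proof. by rewrite dotC dotZl dotC. Qed.

Lemma dot_suml (I : finType) (P : pred I) (F : I -> 'cV[K]_d) v :
  dot (\sum_(i | P i) F i) v = \sum_(i | P i) dot (F i) v.
Proof. by rewrite /dot cdot_suml raddf_sum. Qed.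

Lemma dotuu u : dot u u = \sum_i modulus (u i ord0) ^+ 2.
Proof.
by rewrite /dot cdotE raddf_sum; apply: eq_bigr => i _; exact: re_mul_conj.
Qed.

Lemma dot_ge0 u : 0 <= dot u u.
Proof. by rewrite dotuu sumr_ge0 // => i _; rewrite sqr_ge0. Qed.

Lemma dot_eq0 u : (dot u u == 0) = (u == 0).
Proof.
apply/idP/eqP => [|->]; last by rewrite /dot cdot0l raddf0.
rewrite dotuu psumr_eq0 => [/allP u0|i _]; last exact: sqr_ge0.
apply/matrixP => i j; rewrite ord1 mxE; apply/eqP.
by rewrite -modulus_eq0 -sqrf_eq0; apply: u0; rewrite mem_index_enum.
Qed.

Lemma dot0l u : dot 0 u = 0.
Proof. by rewrite /dot cdot0l raddf0. Qed.

Lemma dot0r u : dot u 0 = 0.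
Proof. by rewrite dotC dot0l. Qed.

Lemma enormE u : enorm u = Num.sqrt (dot u u).
Proof. by rewrite /enorm dotuu. Qed.

Lemma dot_subr_le u v : dot (u - v) (u - v) <= 2 * dot u u + 2 * dot v v.
Proof.
have := dot_ge0 (u - - v); rewrite !(dotBl, dotBr) -[- v]sub0r.
rewrite !(dotBl, dotBr) !(dot0l, dot0r) (dotC v u); lra.
Qed.

Lemma in_group_mulVmx A : in_group A -> map_mx conj A^T *m A = 1%:M.
Proof. by move=> /eqP; rewrite map_trmx. Qed.

Lemma in_group_mulmxV A : in_group A -> A *m map_mx conj A^T = 1%:M.
Proof. by move=> /in_group_mulVmx/mulmx1C. Qed.

Lemma in_group_inv A : in_group A -> invmx A = map_mx conj A^T.
Proof.
move=> gA; have [uA _] := mulmx1_unit (in_group_mulmxV gA).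
by rewrite -[LHS]mulmx1 -(in_group_mulmxV gA) mulKmx.
Qed.

Lemma cdot_in_group A u v : in_group A -> cdot (A *m u) (A *m v) = cdot u v.
Proof. by move=> gA; rewrite cdot_mulmxl mulmxA in_group_mulVmx // mul1mx. Qed.

Lemma in_group1 : in_group (1%:M : 'M[K]_d).
Proof. by rewrite /in_group map_mx1 trmx1 mulmx1. Qed.

Lemma dot_in_group A u v : in_group A -> dot (A *m u) (A *m v) = dot u v.
Proof. by move=> gA; rewrite /dot cdot_in_group. Qed.

End Dot.
End Scalars.

(** * The curvature inequality and the implicit heat flow *)

Section Analysis.
Variables (R : realType) (H : group_family) (d : nat).
Variables (V : finType) (e : rel V) (D : nat).
Hypothesis (D_gt0 : (0 < D)%N) (e_sym : symmetric e) (e_reg : regular e D).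
Local Notation K := (base_field R H).
Local Notation conj := (@field_conj R H).
Local Notation rc := (@of_real R H).
Variable sigma : V -> V -> 'M[K]_d.
Hypothesis sigmaP : signature e sigma.
Local Notation vfun := {ffun V -> 'cV[K]_d}.
Local Notation L := (conn_laplacian e D sigma).

Definition rlap (u : V -> R) (x : V) : R :=
  D%:R^-1 * \sum_(y | e x y) (u y - u x).

Definition rGamma (f g : vfun) (x : V) : R := re (Gamma e D sigma f g x).

Definition hdot (f g : vfun) : K := \sum_x pairing f g x.

Lemma hdotC f g : hdot f g = conj (hdot g f).
Proof. by rewrite rmorph_sum; apply: eq_bigr => x _; exact: cdotC. Qed.

Let DR_gt0 : 0 < D%:R :> R. Proof. by rewrite ltr0n. Qed.

Lemma natr_inv_real n : n%:R^-1 = rc n%:R^-1 :> K.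
Proof. by rewrite fmorphV rmorph_nat. Qed.

Lemma sum_deg (x : V) (c : R) : \sum_(y | e x y) c = c *+ D.
Proof. by rewrite sumr_const; congr (_ *+ _); rewrite -(e_reg x). Qed.

Lemma re_laplacian (u : V -> K) x :
  re (laplacian e D u x) = rlap (fun y => re (u y)) x.
Proof.
rewrite /laplacian natr_inv_real reZ raddf_sum; congr (_ * _).
by apply: eq_bigr => y _; rewrite raddfB.
Qed.

Lemma dot_conn_laplacian f x v :
  dot (L f x) v = D%:R^-1 * \sum_(y | e x y) dot (sigma x y *m f y - f x) v.
Proof. by rewrite ffunE natr_inv_real dotZl dot_suml. Qed.

Lemma eq_rlap u v : u =1 v -> rlap u =1 rlap v.
Proof.
move=> uv x; rewrite /rlap; congr (_ * _).
by apply: eq_bigr => y _; rewrite !uv.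
Qed.

Lemma rGamma_def f g x :
  rGamma f g x = 2^-1 * (rlap (fun y => dot (f y) (g y)) x
                         - dot (f x) (L g x) - dot (L f x) (g x)).
Proof.
rewrite /rGamma /Gamma natr_inv_real reZ !raddfB /= re_laplacian.
by [].
Qed.

(** The isometries sigma_xy leave the product of values unchanged, so the
    Laplacian of the pairing recombines with the two correction terms into a
    product of differences along the edges.  In particular the energy is a
    positive form, and it is local. *)
Lemma rGammaE f g x :
  rGamma f g x = (2 * D%:R)^-1 *
    \sum_(y | e x y) dot (sigma x y *m f y - f x) (sigma x y *m g y - g x).
Proof.
rewrite rGamma_def (dotC (f x)) !dot_conn_laplacian /rlap -!mulrBr mulrA invfM.
congr (_ * _); rewrite -!sumrB; apply: eq_bigr => y exy.
rewrite -(dot_in_group (f y) (g y) (proj1 (sigmaP exy))).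
rewrite !(dotBl, dotBr) (dotC (sigma x y *m g y)) (dotC (g x)); ring.
Qed.

Lemma rGammaC f g x : rGamma f g x = rGamma g f x.
Proof.
by rewrite !rGammaE; congr (_ * _); apply: eq_bigr => y _; exact: dotC.
Qed.

Lemma rGammaBl f g h x : rGamma (f - g) h x = rGamma f h x - rGamma g h x.
Proof.
rewrite !rGammaE -mulrBr -sumrB; congr (_ * _); apply: eq_bigr => y _.
by rewrite -dotBl !ffunE mulmxBr !opprD !opprK addrACA.
Qed.

Lemma rGammaZl a f h x : rGamma (rc a *: f) h x = a * rGamma f h x.
Proof.
rewrite !rGammaE mulrCA; congr (_ * _); rewrite mulr_sumr.
by apply: eq_bigr => y _; rewrite -dotZl !ffunE -scalemxAr scalerBr.
Qed.

Lemma rGamma_ge0 f x : 0 <= rGamma f f x.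
Proof.
rewrite rGammaE mulr_ge0 ?invr_ge0 ?mulr_ge0 ?ler0n // sumr_ge0 // => y _.
exact: dot_ge0.
Qed.

Lemma rGamma_le2 (f : vfun) x :
  (forall y, dot (f y) (f y) <= 1) -> rGamma f f x <= 2.
Proof.
move=> f1; rewrite rGammaE ler_pdivrMl ?mulr_gt0 ?ltr0n //.
rewrite [leRHS](_ : _ = \sum_(y | e x y) 4); last first.
  by rewrite sum_deg -mulr_natr; ring.
apply: ler_sum => y exy; apply: le_trans (dot_subr_le _ _) _.
rewrite (dot_in_group _ _ (proj1 (sigmaP exy))).
have := f1 y; have := f1 x; lra.
Qed.

(** Cauchy-Schwarz: the form is nonnegative on every real combination of f
    and g. *)
Lemma rGamma_CS f g x :
  rGamma f g x <= Num.sqrt (rGamma f f x) * Num.sqrt (rGamma g g x).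
Proof.
set a := rGamma f f x; set b := rGamma f g x; set c := rGamma g g x.
have pos s t : 0 <= s ^+ 2 * a - 2 * s * t * b + t ^+ 2 * c.
  have := rGamma_ge0 (rc s *: f - rc t *: g) x.
  rewrite rGammaBl !rGammaZl ![rGamma _ (_ - _) x]rGammaC !rGammaBl !rGammaZl.
  rewrite (rGammaC g f x) -/a -/b -/c => /le_trans; apply.
  lra.
have a0 : 0 <= a := rGamma_ge0 f x.
have c0 : 0 <= c := rGamma_ge0 g x.
rewrite -sqrtrM // (le_trans (ler_norm b)) // -sqrtr_sqr ler_wsqrtr //.
have [c_eq0|c_neq0] := eqVneq c 0.
  have [->|b_neq0] := eqVneq b 0; first by rewrite expr0n /= mulr_ge0.
  (* On the isotropic line the form is affine in the parameter, and this value
     makes it equal to -1. *)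
  have := pos 1 ((a + 1) / (2 * b)); rewrite c_eq0.
  have -> : 1 ^+ 2 * a - 2 * 1 * ((a + 1) / (2 * b)) * b
            + ((a + 1) / (2 * b)) ^+ 2 * 0 = - 1 by field.
  by rewrite lerNr oppr0 ler10.
have {c_neq0} c_gt0 : 0 < c by rewrite lt_def c_neq0.
have := pos c b; rewrite [X in 0 <= X](_ : _ = c * (a * c - b ^+ 2)).
  by rewrite pmulr_rge0 // subr_ge0.
by ring.
Qed.

(** Self-adjointness: the inverse of sigma_xy is sigma_yx, and the sum over
    oriented edges is symmetric. *)
Lemma hdot_conn_laplacian f g : hdot (L f) g = hdot f (L g).
Proof.
have E (u v : vfun) : hdot (L u) v = D%:R^-1 *
   (\sum_x \sum_(y | e x y) cdot (sigma x y *m u y) (v x)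
    - \sum_x \sum_(y | e x y) cdot (u x) (v x)).
  rewrite mulrBr !mulr_sumr -sumrB; apply: eq_bigr => x _.
  rewrite /pairing -/(cdot _ _) ffunE cdotZl cdot_suml -mulrBr -sumrB.
  by congr (_ * _); apply: eq_bigr => y _; rewrite cdotBl.
rewrite [RHS]hdotC !E rmorphM rmorphB /= natr_inv_real field_conj_real.
congr (_ * (_ - _)); last first.
  rewrite rmorph_sum; apply: eq_bigr => x _; rewrite rmorph_sum.
  by apply: eq_bigr => y _; exact: cdotC.
rewrite rmorph_sum (exchange_big_dep predT) //=; apply: eq_bigr => x _.
rewrite rmorph_sum; apply: eq_big => [y|y eyx]; first by rewrite e_sym.
have [gyx ->] := sigmaP eyx.
by rewrite /= -cdotC in_group_inv // cdot_mulmxl.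
Qed.

Lemma sum_rlap u : \sum_x rlap u x = 0.
Proof.
rewrite -mulr_sumr [X in _ * X](_ : _ = 0) ?mulr0 //.
under eq_bigr do rewrite sumrB.
rewrite sumrB (exchange_big_dep predT) //= -sumrB big1 // => x _.
by apply/eqP; rewrite subr_eq0; apply/eqP/eq_bigl => y; rewrite e_sym.
Qed.

Lemma sum_rGamma f g : \sum_x rGamma f g x = - re (hdot f (L g)).
Proof.
under eq_bigr do rewrite rGamma_def.
rewrite -mulr_sumr !sumrB sum_rlap sub0r.
have -> : \sum_x dot (f x) (L g x) = re (hdot f (L g)) by rewrite raddf_sum.
have -> : \sum_x dot (L f x) (g x) = re (hdot (L f) g) by rewrite raddf_sum.
by rewrite hdot_conn_laplacian; field.
Qed.

(** At a maximum of u its Laplacian is nonpositive.  This is the positivity of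
    the scalar heat flow, in the only form that the estimates need. *)
Lemma max_principle (t c : R) (u : V -> R) : 0 <= t ->
  (forall x, u x - t * rlap u x <= c) -> forall x, u x <= c.
Proof.
move=> t0 uc x.
pose z := [arg max_(i > x) u i]%O.
have zmax y : u y <= u z by rewrite /z; case: arg_maxP => //= i _; apply.
apply: le_trans (zmax x) _; apply: le_trans (uc z).
rewrite lerDl oppr_ge0 mulr_ge0_le0 // mulr_ge0_le0 ?invr_ge0 ?ler0n //.
by rewrite sumr_le0 // => y _; rewrite subr_le0.
Qed.

Lemma rlap_comb (a b : R) (u v : V -> R) x :
  rlap (fun y => a * u y + b * v y) x = a * rlap u x + b * rlap v x.
Proof.
rewrite /rlap !(mulrCA _ D%:R^-1) -mulrDr; congr (_ * _).
by rewrite !mulr_sumr -big_split /=; apply: eq_bigr => y _; ring.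
Qed.

(** An implicit Euler step of length t leads from f to g along the heat flow of
    the connection Laplacian. *)
Definition euler_step (t : R) (f g : vfun) := f = g - rc t *: L g.

(** Expand the square of f = g - t L g: the cross term is twice the energy up
    to the Laplacian of the squared length of g, and the last term is a
    square. *)
Lemma euler_step_dot t f g x : euler_step t f g -> 0 <= t ->
  dot (g x) (g x) - t * rlap (fun y => dot (g y) (g y)) x + 2 * t * rGamma g g x
  <= dot (f x) (f x).
Proof.
move=> -> t0; rewrite rGamma_def.
have -> : (g - rc t *: L g) x = g x - rc t *: L g x.
  by rewrite ffunE [in LHS]ffunE [in LHS]ffunE.
rewrite !(dotBl, dotBr) !(dotZl, dotZr) (dotC (L g x) (g x)).
have := mulr_ge0 (sqr_ge0 t) (dot_ge0 (L g x)); set q := dot (L g x) _.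
by move=> q0; rewrite -subr_ge0 (le_trans q0) //; lra.
Qed.

Hypothesis curv : CD e D sigma 0.

Lemma CD_rlap g x : 2 * rGamma g (L g) x <= rlap (rGamma g g) x.
Proof.
have := curv g x; rewrite rmorph0 mul0r => /re_ge0.
rewrite /Gamma2 natr_inv_real reZ !raddfB /= re_laplacian -!/(rGamma _ _ _).
by rewrite (rGammaC (L g)) /rGamma; lra.
Qed.

(** The same expansion one level higher, for the energy instead of the squared
    length; here nonnegative curvature controls the cross term. *)
Lemma euler_step_rGamma t f g x : euler_step t f g -> 0 <= t ->
  rGamma g g x - t * rlap (rGamma g g) x <= rGamma f f x.
Proof.
move=> -> t0; rewrite rGammaBl !rGammaZl ![rGamma _ (_ - _) x]rGammaC.
rewrite !rGammaBl !rGammaZl (rGammaC (L g) g).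
have := CD_rlap g x; have := rGamma_ge0 (L g) x.
set q := rGamma (L g) _ x; set p := rGamma g (L g) x; set r := rlap _ x.
move=> /(mulr_ge0 (sqr_ge0 t)) q0 /(ler_wpM2l t0) r0; lra.
Qed.

Lemma euler_step_inj (t : R) g : 0 <= t -> euler_step t 0 g -> g = 0.
Proof.
move=> t0 stepg; apply/ffunP => x; rewrite ffunE; apply/eqP.
rewrite -dot_eq0 eq_le dot_ge0 andbT; move: x; apply: (max_principle t0) => x.
have := euler_step_dot x stepg t0; rewrite ffunE dot0l; apply: le_trans.
by rewrite lerDl !mulr_ge0 ?rGamma_ge0.
Qed.

(** The operator 1 - t L of a finite-dimensional space is injective, hence
    onto. *)
Lemma euler_step_ex (t : R) f : 0 <= t -> exists g, euler_step t f g.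
Proof.
move=> t0; pose A : 'End(vfun) := (\1 - rc t *: linfun L)%VF.
have AE g : A g = g - rc t *: L g.
  by rewrite add_lfunE opp_lfunE scale_lfunE id_lfunE lfunE.
have kerA : lker A == 0%VS.
  rewrite -subv0; apply/subvP => g; rewrite memv_ker memv0 => /eqP Ag0.
  by apply/eqP/(euler_step_inj t0); rewrite /euler_step -AE.
by exists ((A^-1)%VF f); rewrite /euler_step -AE lker0_lfunVK.
Qed.

Section Flow.
Variables (t : R) (F : nat -> vfun).
Hypotheses (t_ge0 : 0 <= t) (F_step : forall n, euler_step t (F n) (F n.+1)).
Hypothesis F0_le1 : forall x, dot (F 0 x) (F 0 x) <= 1.

(** Discrete form of |P_s f|^2 + 2 s Gamma(P_s f) <= sup |f|^2, with s = n t.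
    The energy is taken one step later than the squared length: the step from
    F n to F n.+1 gains 2 t times the energy of F n.+1, which is the difference
    between the terms with the coefficients n + 1 and n. *)
Lemma flow_bound n x :
  dot (F n x) (F n x) + 2 * t * n%:R * rGamma (F n.+1) (F n.+1) x <= 1.
Proof.
elim: n x => [|n IHn] x; first by rewrite mulr0 mul0r addr0.
move: x; apply: (max_principle t_ge0) => x.
rewrite (@eq_rlap _ (fun y => 1 * dot (F n.+1 y) (F n.+1 y)
    + (2 * t * n.+1%:R) * rGamma (F n.+2) (F n.+2) y)); last first.
  by move=> y; rewrite mul1r.
rewrite rlap_comb; apply: le_trans (IHn x).
have := euler_step_dot x (F_step n) t_ge0.
have := euler_step_rGamma x (F_step n.+1) t_ge0.
set a := rGamma _ _ x; set a' := rGamma _ _ x; set b := rlap _ x.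
set b' := rlap _ x; set c := dot _ _; set c' := dot _ _.
have : 0 <= 2 * t * n.+1%:R by rewrite !mulr_ge0.
rewrite -natr1; set m := n%:R => m0 /(ler_wpM2l m0); lra.
Qed.

Lemma flow_rGamma n x : 0 < t ->
  Num.sqrt (rGamma (F n.+2) (F n.+2) x) <= (Num.sqrt (2 * t * n.+1%:R))^-1.
Proof.
move=> t_gt0; rewrite -sqrtrV ?mulr_ge0 ?ler0n // ler_wsqrtr //.
rewrite -[leRHS]mul1r ler_pdivlMr ?mulr_gt0 ?ltr0n // mulrC.
by apply: le_trans (flow_bound n.+1 x); rewrite lerDr dot_ge0.
Qed.

Lemma flow_rGamma1 x : Num.sqrt (rGamma (F 1) (F 1) x) <= Num.sqrt 2.
Proof.
rewrite ler_wsqrtr // rGamma_le2 //; apply: (max_principle t_ge0) => y.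
apply: le_trans (F0_le1 y); apply: le_trans (euler_step_dot y (F_step 0) t_ge0).
by rewrite lerDl !mulr_ge0 ?rGamma_ge0.
Qed.

(** The flow is tested against its own starting point, so summation by parts
    moves one derivative onto F 0 and leaves the gradient of F n.+1, which the
    smoothing bound controls. *)
Lemma flow_increment n :
  re (hdot (F 0) (F n) - hdot (F 0) (F n.+1))
  = t * \sum_x rGamma (F 0) (F n.+1) x.
Proof.
rewrite sum_rGamma -[t * _]opprK -mulrN opprK -reZ -raddfN /=; congr re.
rewrite -sumrB mulr_sumr -sumrN; apply: eq_bigr => x _.
rewrite /pairing -!/(cdot _ _) -cdotBr (F_step n) !ffunE.
rewrite addrAC subrr sub0r -[- _]sub0r cdotBr cdot0r sub0r cdotZr.
by rewrite field_conj_real.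
Qed.

Lemma flow_increment_le n c :
  (forall x, Num.sqrt (rGamma (F n.+1) (F n.+1) x) <= c) ->
  re (hdot (F 0) (F n) - hdot (F 0) (F n.+1))
  <= t * c * \sum_x Num.sqrt (rGamma (F 0) (F 0) x).
Proof.
move=> Fc; rewrite flow_increment -mulrA ler_wpM2l // mulr_sumr.
apply: ler_sum => x _; apply: le_trans (rGamma_CS _ _ _) _.
by rewrite mulrC ler_wpM2r ?sqrtr_ge0.
Qed.

Lemma sum_invsqrt_le n :
  \sum_(i < n) (Num.sqrt i.+1%:R)^-1 <= 2 * Num.sqrt n%:R :> R.
Proof.
elim: n => [|n IHn]; first by rewrite big_ord0 sqrtr0 mulr0.
rewrite big_ord_recr /=; apply: le_trans (lerD IHn (lexx _)) _.
set a := Num.sqrt n%:R; set b := Num.sqrt n.+1%:R.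
have a0 : 0 <= a := sqrtr_ge0 _.
have b0 : 0 < b by rewrite sqrtr_gt0 ltr0n.
have ab : b ^+ 2 = a ^+ 2 + 1 by rewrite !sqr_sqrtr ?ler0n // natr1.
rewrite -(ler_pM2r b0) mulrDl mulVf ?gt_eqF // -subr_ge0.
apply: le_trans (sqr_ge0 (b - a)) _; lra.
Qed.

(** Summing the increments, with gradients of size 1 / sqrt (2 t i), gives
    sqrt (2 s) times the total gradient of F 0 for the time s = n t.  The very
    first step, where only the trivial gradient bound sqrt 2 is available, costs
    the extra t sqrt 2, which vanishes with the step length. *)
Lemma flow_displacement n : 0 < t ->
  re (hdot (F 0) (F 0) - hdot (F 0) (F n.+1))
  <= (t * Num.sqrt 2 + Num.sqrt (2 * t * n%:R))
     * \sum_x Num.sqrt (rGamma (F 0) (F 0) x).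
Proof.
move=> t_gt0; set S := \sum_x _.
have S0 : 0 <= S by rewrite sumr_ge0 // => x _; exact: sqrtr_ge0.
suff H1 : re (hdot (F 0) (F 0) - hdot (F 0) (F n.+1)) <=
    (t * Num.sqrt 2 + t * \sum_(i < n) (Num.sqrt (2 * t * i.+1%:R))^-1) * S.
  apply: le_trans H1 _; rewrite ler_wpM2r // lerD2l.
  have tt0 : 0 <= 2 * t by rewrite mulr_ge0.
  have q0 : 0 < Num.sqrt (2 * t) by rewrite sqrtr_gt0 mulr_gt0.
  under eq_bigr => i _ do rewrite (sqrtrM _ tt0) invfM.
  rewrite -mulr_sumr (sqrtrM _ tt0) mulrA.
  have qE : t / Num.sqrt (2 * t) * 2 = Num.sqrt (2 * t).
    apply: (mulIf (lt0r_neq0 q0)); rewrite mulrAC mulfVK ?gt_eqF //.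
    by rewrite -expr2 sqr_sqrtr // mulrC.
  rewrite -[X in _ <= X * _]qE -[X in _ <= X]mulrA ler_wpM2l ?sum_invsqrt_le //.
  by rewrite mulr_ge0 // invr_ge0 ltW.
elim: n => [|n IHn].
  rewrite big_ord0 mulr0 addr0 flow_increment_le // => x.
  exact: flow_rGamma1.
rewrite big_ord_recr /= mulrDr addrA mulrDl.
rewrite -(subrKA (hdot (F 0) (F n.+1))) raddfD /= lerD //.
by apply: flow_increment_le => x; exact: flow_rGamma.
Qed.

End Flow.
End Analysis.

(** * Diagonalisation of the connection Laplacian *)

(** A row base of the matrix, read in the basis b, is a basis of the
    subspace. *)
Lemma dim_vsof (F : fieldType) (vT : vectType F) (b : (\dim {:vT}).-tuple vT)
    (A : 'M[F]_(\dim {:vT})) :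
  basis_of {:vT} b -> \dim (vsof b A) = \rank A.
Proof.
move=> bP; pose B := row_base A.
pose X := mktuple (fun i => vecof b (row i B)).
have combE (v : 'rV_(\rank A)) :
    vecof b (v *m B) = \sum_i v 0 i *: vecof b (row i B).
  by rewrite mulmx_sum_row linear_sum; apply: eq_bigr => i _; rewrite linearZ.
have nthX (i : 'I_(\rank A)) : X`_i = vecof b (row i B).
  by rewrite -tnth_nth tnth_mktuple.
apply: (@size_basis _ _ _ _ X).
apply/andP; split.
  rewrite eqEsubv; apply/andP; split.
    apply/span_subvP => _ /mapP[i _ ->].
    rewrite -rVof_sub // vecofK // (submx_trans (row_sub i B)) //.
    by rewrite (eq_row_base A).
  apply/subvP => v; rewrite -rVof_sub // -(eq_row_base A).
  case/submxP => c /(congr1 (vecof b)); rewrite rVofK // => ->.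
  rewrite combE memv_suml // => i _; rewrite memvZ // memv_span //.
  by apply/mapP; exists i; rewrite ?mem_enum.
apply/freeP => c; under eq_bigr do rewrite nthX.
move=> c0 i; have := combE (\row_j c j).
under eq_bigr do rewrite mxE.
rewrite c0 => /eqP; rewrite vecof_eq0 //.
rewrite mulmx_free_eq0 ?row_base_free // => /eqP/rowP/(_ i).
by rewrite !mxE.
Qed.

Section Diagonalisation.
Variables (R : rcfType) (N : nat) (A : 'M[R[i]]_N).
Hypothesis hermA : A \is hermsymmx.
Local Notation P := (spectralmx A).

Definition eigval (l : 'I_N) : R := complex.Re (spectral_diag A 0 l).

Lemma spectral_diagE l : spectral_diag A 0 l = (eigval l)%:C%C.
Proof.
have /mxOverP/(_ 0 l) := hermitian_spectral_diag_real hermA.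
by move/RRe_real.
Qed.

Lemma mul_invspectral : A *m invmx P = invmx P *m diag_mx (spectral_diag A).
Proof.
have /orthomx_spectralP {1}-> := hermitian_normalmx hermA.
by rewrite mulmxK // spectral_unit.
Qed.

Lemma invspectral_coord (u : 'rV_N) l :
  (u *m A *m invmx P) 0 l = (eigval l)%:C%C * (u *m invmx P) 0 l.
Proof.
rewrite -mulmxA mul_invspectral mulmxA mul_mx_diag mxE spectral_diagE.
by rewrite mulrC.
Qed.

(** The rows of the diagonalising matrix with eigenvalue a span the
    eigenspace of a. *)
Lemma rank_eigenspace (a : R) :
  \rank (eigenspace A a%:C%C) = #|[set l | eigval l == a]|.
Proof.
set T := [set _ | _]; pose B := rowsub (fun i : 'I_#|T| => enum_val i) P.
have /unitarymxP PP := spectral_unitarymx A.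
have rankB : \rank B = #|T|.
  apply/mxrank_unitary/unitarymxP/matrixP => i j.
  have := congr1 (fun X : matrix _ _ _ => X (enum_val i) (enum_val j)) PP.
  rewrite !mxE (inj_eq enum_val_inj) => <-.
  by apply: eq_bigr => l _; rewrite !mxE.
rewrite -rankB; apply/eqmx_rank/andP; split; apply/rV_subP => u.
  move=> /eigenspaceP uA.
  have uE : u = (u *m invmx P) *m P by rewrite mulmxKV // spectral_unit.
  rewrite uE mulmx_sum_row summx_sub // => l _.
  have [lT|lT] := boolP (l \in T).
    rewrite scalemx_sub // (_ : row l P = row (enum_rank_in lT l) B).
      exact: row_sub.
    by apply/rowP => j; rewrite !mxE enum_rankK_in.
  suff -> : (u *m invmx P) 0 l = 0 by rewrite scale0r sub0mx.
  have := invspectral_coord u l; rewrite uA -scalemxAl mxE.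
  move/eqP; rewrite -subr_eq0 -mulrBl mulf_eq0 => /orP[|/eqP //].
  rewrite -rmorphB => /eqP/complexI/eqP; rewrite subr_eq0 eq_sym => la.
  by rewrite inE la in lT.
move=> /submxP[c ->]; apply: submx_trans (submxMl c B) _.
apply/row_subP => i; apply/eigenspaceP.
have -> : row i B = row (enum_val i) P by apply/rowP => j; rewrite !mxE.
rewrite -row_mul.
have -> : P *m A = diag_mx (spectral_diag A) *m P.
  have /orthomx_spectralP {2}-> := hermitian_normalmx hermA.
  by rewrite !mulmxA mulmxV ?spectral_unit // mul1mx.
have := enum_valP i; rewrite inE => /eqP <-.
by rewrite row_mul row_diag_mx -scalemxAl -rowE spectral_diagE.
Qed.

Lemma spectral_parseval (u v : 'rV[R[i]]_N) :
  \sum_l (u *m invmx P) 0 l * ((v *m invmx P) 0 l)^*%C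
  = \sum_l u 0 l * (v 0 l)^*%C.
Proof.
have E (w w' : 'rV[R[i]]_N) :
    \sum_l w 0 l * (w' 0 l)^*%C = (w *m w'^t*%sesqui) 0 0.
  by rewrite mxE; apply: eq_bigr => l _; rewrite !mxE.
rewrite !E {2}invmx_unitary ?spectral_unitarymx // trmx_mul map_mxM trmxCK.
by rewrite mulmxA mulmxKV // spectral_unit.
Qed.

End Diagonalisation.

Lemma count_enum (T : finType) (p : pred T) : count p (enum T) = #|p|.
Proof. by rewrite cardE enumT -size_filter; congr size; exact: eq_filter. Qed.

Section RealPart.
Variable R : rcfType.

Lemma Re_sum (J : finType) (F : J -> R[i]) :
  complex.Re (\sum_j F j) = \sum_j complex.Re (F j).
Proof. exact: raddf_sum. Qed.

Lemma Re_mulcJ_ge0 (z : R[i]) : 0 <= complex.Re (z * z^*%C).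
Proof. by have := mulcJ_ge0 z; rewrite lecE => /andP[]. Qed.

End RealPart.

Section Spectrum.
Variables (R : realType) (H : group_family) (d : nat).
Variables (V : finType) (e : rel V) (D : nat).
Hypothesis (D_gt0 : (0 < D)%N) (e_sym : symmetric e) (e_reg : regular e D).
Local Notation K := (base_field R H).
Local Notation conj := (@field_conj R H).
Local Notation rc := (@of_real R H).
Variable sigma : V -> V -> 'M[K]_d.
Hypothesis sigmaP : signature e sigma.
Local Notation vfun := {ffun V -> 'cV[K]_d}.
Local Notation L := (conn_laplacian e D sigma).
Local Notation negL := (neg_conn_laplacian e D sigma).
Local Notation N := (\dim {: vfun}).

Lemma dim_vfun : N = #|{: V * 'I_d}|.
Proof. by rewrite dimvf card_prod card_ord -[X in (_ * X)%N](muln1 d). Qed.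

(** The basis is indexed by a vertex and a coordinate of K^d, so that it is
    orthonormal and the matrix of a self-adjoint operator is Hermitian. *)
Definition coord_index (i : 'I_N) : V * 'I_d :=
  enum_val (cast_ord dim_vfun i).

Definition delta_vfun (p : V * 'I_d) : vfun :=
  [ffun x => \col_j ((x, j) == p)%:R].

Definition delta_basis : N.-tuple vfun :=
  mktuple (fun i => delta_vfun (coord_index i)).

Lemma coord_index_bij : bijective coord_index.
Proof.
exists (fun p => cast_ord (esym dim_vfun) (enum_rank p)) => [i|p].
  by rewrite /coord_index enum_valK cast_ordK.
by rewrite /coord_index cast_ordKV enum_rankK.
Qed.

Lemma nth_delta_basis (i : 'I_N) : delta_basis`_i = delta_vfun (coord_index i).
Proof. by rewrite -tnth_nth tnth_mktuple. Qed.

Lemma sum_deltaE (c : 'I_N -> K) i :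
  (\sum_k c k *: delta_basis`_k) (coord_index i).1 (coord_index i).2 ord0 = c i.
Proof.
rewrite sum_ffunE summxE (bigD1 i) //= big1 ?addr0 => [|k ki].
  by rewrite nth_delta_basis !ffunE !mxE -surjective_pairing eqxx mulr1.
rewrite nth_delta_basis !ffunE !mxE -surjective_pairing.
by rewrite (inj_eq (bij_inj coord_index_bij)) eq_sym (negPf ki) mulr0.
Qed.

Lemma delta_basisP : basis_of {: vfun} delta_basis.
Proof.
rewrite basisEfree subvf size_tuple leqnn !andbT.
apply/freeP => c c0 i; rewrite -(sum_deltaE c i) c0.
by rewrite !ffunE !mxE.
Qed.

Lemma rVof_delta f i :
  rVof delta_basis f 0 i = f (coord_index i).1 (coord_index i).2 ord0.
Proof.
have bP := delta_basisP.
rewrite -[in RHS](rVofK bP f) /vecof.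
by rewrite (sum_deltaE (fun k => rVof delta_basis f 0 k)).
Qed.

Lemma hdot_coord f g :
  hdot f g = \sum_i rVof delta_basis f 0 i * conj (rVof delta_basis g 0 i).
Proof.
under [RHS]eq_bigr do rewrite !rVof_delta.
rewrite -(reindex (fun i => coord_index i) (onW_bij predT coord_index_bij)
  (F := fun p => f p.1 p.2 ord0 * conj (g p.1 p.2 ord0))) /=.
rewrite -(pair_bigA _ (fun x j => f x j ord0 * conj (g x j ord0))) /=.
by apply: eq_bigr => x _; rewrite /pairing -/(cdot _ _) cdotE.
Qed.

Definition conn_matrix : 'M[R[i]]_N :=
  map_mx (@to_complex R H) (mxof delta_basis delta_basis negL).

Lemma neg_conn_laplacianE f : negL f = - L f.
Proof. by rewrite opp_lfunE lfunE. Qed.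

Lemma conn_matrix_herm : conn_matrix \is hermsymmx.
Proof.
have bP := delta_basisP.
apply/is_hermitianmxP; rewrite expr0 scale1r; apply/matrixP => i j.
rewrite !mxE -[RHS]/(conjc _) -to_complex_conj; congr to_complex.
have E (f : vfun) k : rVof delta_basis f 0 k = hdot f delta_basis`_k.
  rewrite hdot_coord rVofE // (bigD1 k) //= [delta_mx _ _ _ _]mxE !eqxx.
  rewrite rmorph1 mulr1 big1 ?addr0 // => l lk.
  by rewrite [delta_mx _ _ _ _]mxE (negPf lk) andbF rmorph0 mulr0.
rewrite /= !vecof_delta.
have hN (u v : vfun) : hdot (- u) v = - hdot u v.
  rewrite -sumrN; apply: eq_bigr => x _; rewrite /pairing -!/(cdot _ _).
  by rewrite ffunE -[- u x]sub0r cdotBl cdot0l sub0r.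
have := E (negL delta_basis`_i) j; have := E (negL delta_basis`_j) i.
rewrite !mxE => -> ->; rewrite !neg_conn_laplacianE !hN rmorphN /=.
by rewrite (hdot_conn_laplacian _ e_sym sigmaP) (hdotC _ (L _)).
Qed.

(** Coordinates in an orthonormal basis of eigenvectors of the complexified
    operator; they are complex numbers even when K is real. *)
Definition spectral_coord (f : vfun) (l : 'I_N) : R[i] :=
  (map_mx (@to_complex R H) (rVof delta_basis f)
     *m invmx (spectralmx conn_matrix)) 0 l.

Local Notation ev := (eigval conn_matrix).

Lemma spectral_coordB f g l :
  spectral_coord (f - g) l = spectral_coord f l - spectral_coord g l.
Proof. by rewrite /spectral_coord linearB map_mxB mulmxBl !mxE. Qed.

Lemma spectral_coordZ a f l :
  spectral_coord (rc a *: f) l = a%:C%C * spectral_coord f l.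
Proof.
by rewrite /spectral_coord linearZ map_mxZ -scalemxAl mxE /= to_complex_real.
Qed.

Lemma spectral_coord_laplacian f l :
  spectral_coord (L f) l = - ((ev l)%:C%C * spectral_coord f l).
Proof.
have <- : - negL f = L f by rewrite neg_conn_laplacianE opprK.
rewrite -sub0r spectral_coordB {1}/spectral_coord linear0 map_mx0 mul0mx mxE.
rewrite sub0r /spectral_coord (rVof_app _ delta_basisP) map_mxM.
by rewrite (invspectral_coord conn_matrix_herm).
Qed.

Lemma parseval f g :
  to_complex (hdot f g) = \sum_l spectral_coord f l * (spectral_coord g l)^*%C.
Proof.
rewrite /spectral_coord spectral_parseval hdot_coord rmorph_sum.
by apply: eq_bigr => i _; rewrite rmorphM /= to_complex_conj !mxE.
Qed.

(** Extending the scalars from K to R[i] does not change the rank of the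
    eigenspaces, so the multiplicities over K are those of the complex
    diagonalisation. *)
Lemma dim_leigenspace (a : R) :
  \dim (leigenspace negL (rc a)) = #|[set l | ev l == a]|.
Proof.
rewrite (leigenspaceE delta_basisP) (dim_vsof _ delta_basisP).
rewrite -(rank_eigenspace conn_matrix_herm) -(to_complex_real H).
by rewrite -map_eigenspace mxrank_map.
Qed.

(** An eigenvector with eigenvalue a has total energy a times its squared
    norm. *)
Lemma eigval_ge0 l : 0 <= ev l.
Proof.
have : leigenspace negL (rc (ev l)) != 0%VS.
  rewrite -dimv_eq0 dim_leigenspace -lt0n card_gt0.
  by apply/set0Pn; exists l; rewrite inE.
rewrite -subv0 => /subvPn[f]; rewrite memv_ker memv0 => /eqP Lf f0.
have {}Lf : L f = - (rc (ev l) *: f).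
  move: Lf; rewrite add_lfunE neg_conn_laplacianE opp_lfunE.
  rewrite scale_lfunE id_lfunE.
  by move/eqP; rewrite subr_eq0 => /eqP <-; rewrite opprK.
have ff : 0 < \sum_x dot (f x) (f x).
  rewrite lt_def sumr_ge0 ?andbT => [|x _]; last exact: dot_ge0.
  apply: contra f0 => /eqP/psumr_eq0P f0; apply/eqP/ffunP => x.
  by rewrite ffunE; apply/eqP; rewrite -dot_eq0 f0 // => y _; exact: dot_ge0.
have := sum_rGamma D e_sym sigmaP f f; rewrite Lf.
have -> : - re (hdot f (- (rc (ev l) *: f))) = ev l * \sum_x dot (f x) (f x).
  rewrite raddf_sum mulr_sumr -sumrN; apply: eq_bigr => x _.
  rewrite /= -[re _]/(dot (f x) ((- (rc (ev l) *: f)) x)).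
  have -> : (- (rc (ev l) *: f)) x = 0 - rc (ev l) *: f x.
    by rewrite sub0r ffunE [in LHS]ffunE.
  by rewrite dotBr dot0r dotZr sub0r opprK.
move=> E; rewrite -(pmulr_lge0 _ ff) -E sumr_ge0 // => x _.
exact: rGamma_ge0.
Qed.

Lemma spectrumE : spectrum e D sigma = sort <=%R (codom ev).
Proof.
apply/perm_sort_leP; set A := [set t | _]%classic.
have AE : A = [set` codom ev]%classic.
  apply/seteqP.
  split => t; rewrite /A /= /leigenvalue -dimv_eq0 dim_leigenspace.
    rewrite -lt0n card_gt0 => /set0Pn[l]; rewrite inE => /eqP <-.
    exact: codom_f.
  move=> /codomP[l ->]; rewrite -lt0n card_gt0; apply/set0Pn.
  by exists l; rewrite inE.
have Afin : finite_set A by rewrite AE; exact: finite_seq.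
have memA t : (t \in (fset_set A : seq R)) = (t \in codom ev).
  by rewrite -[LHS]/(t \in fset_set A) in_fset_set // AE mem_setE.
apply: perm_trans (perm_count_undup (codom ev)).
apply: perm_trans (perm_flatten _ ) _; last exact: perm_refl.
have -> : [seq nseq (count_mem x (codom ev)) x | x <- undup (codom ev)]
  = [seq nseq (\dim (leigenspace negL (rc t))) t | t <- undup (codom ev)].
  apply: eq_map => t; congr nseq; rewrite dim_leigenspace count_map.
  by rewrite count_enum; apply: eq_card => l; rewrite !inE.
apply: perm_map; apply: uniq_perm; rewrite ?fset_uniq ?undup_uniq // => t.
by rewrite mem_undup memA.
Qed.

Lemma card_eigval_lt_lambda m : (0 < m)%N ->
  (#|[set l | (ev l < lambda e D sigma m)%R]| < m)%N.
Proof.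
move=> m0; rewrite /lambda spectrumE; set s := sort _ _.
have ss : sorted <=%R s by exact: sort_le_sorted.
have s0 x : x \in s -> 0 <= x.
  by rewrite mem_sort => /codomP[l ->]; exact: eigval_ge0.
have cE x : #|[set l | ev l < x]| = count (< x) s.
  rewrite /s count_sort count_map count_enum.
  by apply: eq_card => l; rewrite !inE.
rewrite cE; set x := nth _ _ _.
rewrite ltnNge; apply/negP => mc.
have : nth 0 s m.-1 < x by apply: nth_count_lt => //; rewrite prednK.
by rewrite ltxx.
Qed.

Lemma lambda_ge0 m : 0 <= lambda e D sigma m.
Proof.
rewrite /lambda spectrumE; set s := sort _ _.
have [ms|sm] := ltnP m.-1 (size s); last by rewrite nth_default.
have := mem_nth 0 ms; rewrite mem_sort => /codomP[l ->]; exact: eigval_ge0.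
Qed.

(** Bessel's inequality for the l-th basis vector.  The vector q is the l-th row
    of the orthogonal projection onto the span of the family; this matrix is
    idempotent and Hermitian, so that its diagonal entry w satisfies
    w ^ 2 <= w. *)
Lemma bessel (I : finType) (psi : I -> vfun) l :
  (forall i j, hdot (psi i) (psi j) = (i == j)%:R) ->
  \sum_i complex.Re (spectral_coord (psi i) l * (spectral_coord (psi i) l)^*%C)
  <= 1.
Proof.
move=> psiP; pose c i l := spectral_coord (psi i) l.
have cc i j : \sum_k c i k * (c j k)^*%C = (i == j)%:R.
  by rewrite -parseval psiP rmorph_nat.
pose q k := \sum_i (c i l)^*%C * c i k.
have qq : \sum_k q k * (q k)^*%C = q l.
  transitivity (\sum_i \sum_j (c i l)^*%C * c j l * \sum_k c i k * (c j k)^*%C).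
    rewrite /q; under eq_bigr => k _.
      rewrite rmorph_sum mulr_suml; under eq_bigr do rewrite mulr_sumr.
      over.
    rewrite exchange_big; apply: eq_bigr => i _.
    rewrite exchange_big; apply: eq_bigr => j _.
    rewrite mulr_sumr; apply: eq_bigr => k _.
    by rewrite rmorphM /= conjcK; ring.
  apply: eq_bigr => i _.
  rewrite (bigD1 i) //= [X in _ + X]big1 ?addr0 => [|j ji].
    by rewrite cc eqxx mulr1.
  by rewrite cc eq_sym (negPf ji) mulr0.
set w := \sum_i _.
have wE : q l = w%:C%C.
  rewrite /w -Re_sum RRe_real; last first.
    by apply: rpred_sum => i _; rewrite ger0_real ?mulcJ_ge0.
  by apply: eq_bigr => i _; rewrite mulrC.
have w0 : 0 <= w.
  by rewrite sumr_ge0 // => i _; exact: Re_mulcJ_ge0.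
have : w ^+ 2 <= w.
  rewrite -{2}[w]/(complex.Re w%:C%C) -wE -qq Re_sum (bigD1 l) //=.
  rewrite wE conjc_real.
  rewrite -rmorphM /= -expr2 lerDl sumr_ge0 // => k _.
  exact: Re_mulcJ_ge0.
move: w0; rewrite le_eqVlt => /orP[/eqP <- //|w0].
by rewrite expr2 -[leRHS]mulr1 ler_pM2l.
Qed.

(** Ky Fan's inequality for the trace of the flow.  An orthonormal family of m
    functions has weights w l in [0, 1] on the eigenvectors, of total m; at most
    m - 1 of the eigenvectors have an eigenvalue below lambda_m, and on all
    others the flow contracts at least by the factor of lambda_m. *)
Lemma flow_trace (I : finType) (t : R) (F : I -> nat -> vfun) n :
  0 <= t -> (0 < #|I|)%N ->
  (forall i j, hdot (F i 0) (F j 0) = (i == j)%:R) ->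
  (forall i k, euler_step e D sigma t (F i k) (F i k.+1)) ->
  \sum_i re (hdot (F i 0) (F i n))
  <= #|I|%:R - 1 + (1 + t * lambda e D sigma #|I|) ^- n.
Proof.
move=> t0 I0 orthF stepF; set lam := lambda _ _ _ _.
have ev1 l : 1 <= 1 + t * ev l by rewrite lerDl mulr_ge0 ?eigval_ge0.
have lam1 : 1 <= 1 + t * lam by rewrite lerDl mulr_ge0 ?lambda_ge0.
have coordF i k l :
    spectral_coord (F i k) l
    = ((1 + t * ev l) ^- k)%:C%C * spectral_coord (F i 0) l.
  elim: k => [|k IHk]; first by rewrite expr0 invr1 mul1r.
  have : spectral_coord (F i k) l
      = (1 + t * ev l)%:C%C * spectral_coord (F i k.+1) l.
    rewrite [in LHS](stepF i k) spectral_coordB spectral_coordZ.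
    rewrite spectral_coord_laplacian mulrN opprK rmorphD rmorph1 rmorphM /=.
    by rewrite mulrDl mul1r mulrA.
  rewrite IHk => /(congr1 (fun z => ((1 + t * ev l)^-1)%:C%C * z)).
  have ne0 : 1 + t * ev l != 0 by rewrite gt_eqF // (lt_le_trans ltr01).
  rewrite !mulrA -!rmorphM /= mulVf // rmorph1 mul1r => <-.
  by rewrite exprS invfM.
pose w l := \sum_i complex.Re
  (spectral_coord (F i 0) l * (spectral_coord (F i 0) l)^*%C).
have w1 l : w l <= 1 by apply: bessel.
have w0 l : 0 <= w l.
  by rewrite sumr_ge0 // => i _; exact: Re_mulcJ_ge0.
have flowE k : \sum_i re (hdot (F i 0) (F i k))
    = \sum_l w l * (1 + t * ev l) ^- k.
  under eq_bigr => i _ do rewrite -Re_to_complex parseval Re_sum.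
  rewrite exchange_big; apply: eq_bigr => l _.
  rewrite mulr_suml; apply: eq_bigr => i _.
  rewrite (coordF i k); case: (spectral_coord _ _) => a b /=; ring.
have sumw : \sum_l w l = #|I|%:R.
  have := flowE 0; under [RHS]eq_bigr do rewrite expr0 invr1 mulr1.
  move=> <-; under eq_bigr do rewrite orthF eqxx -(rmorph1 rc) re_real.
  by rewrite sumr_const.
set Q := (1 + t * lam) ^- n.
have Q1 : Q <= 1.
  by rewrite invf_le1 ?exprn_ege1 ?exprn_gt0 // (lt_le_trans ltr01).
have wQ l : w l * (1 + t * ev l) ^- n
    <= w l * Q + (1 - Q) * (ev l < lam)%R%:R.
  have q1 : (1 + t * ev l) ^- n <= 1.
    by rewrite invf_le1 ?exprn_ege1 ?exprn_gt0 // (lt_le_trans ltr01).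
  have [_|lam_le] := ltP (ev l) lam.
    have := ler_wpM2l (w0 l) q1; rewrite mulr1 [true%:R](_ : _ = 1) //.
    have Q1' : 0 <= 1 - Q by rewrite subr_ge0.
    have := ler_wpM2r Q1' (w1 l); lra.
  rewrite [false%:R](_ : _ = 0) // mulr0 addr0 ler_wpM2l //.
  rewrite lef_pV2 ?posrE ?exprn_gt0 ?(lt_le_trans ltr01) //.
  by rewrite lerXn2r ?nnegrE ?(le_trans ler01) // lerD2l ler_wpM2l.
rewrite flowE; apply: le_trans (ler_sum _ (fun l _ => wQ l)) _.
rewrite big_split /= -mulr_suml sumw -mulr_sumr.
have -> : \sum_l (ev l < lam)%R%:R = #|[set l | ev l < lam]|%:R :> R.
  rewrite -sum1_card natr_sum [RHS]big_mkcond; apply: eq_bigr => l _.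
  by rewrite inE; case: ifP.
have : #|[set l | ev l < lam]|%:R <= #|I|%:R - 1 :> R.
  by rewrite lerBrDr natr1 ler_nat card_eigval_lt_lambda.
have Q1' : 0 <= 1 - Q by rewrite subr_ge0.
move/(ler_wpM2l Q1'); lra.
Qed.

End Spectrum.

(** * Test functions supported on a Cheeger family *)

Section TestFunctions.
Variables (R : realType) (H : group_family) (d : nat).
Variables (V : finType) (e : rel V) (D : nat).
Hypothesis (d_gt0 : (0 < d)%N) (D_gt0 : (0 < D)%N).
Hypothesis (e_sym : symmetric e) (e_irr : irreflexive e) (e_reg : regular e D).
Local Notation K := (base_field R H).
Local Notation conj := (@field_conj R H).
Local Notation rc := (@of_real R H).
Variable sigma : V -> V -> 'M[K]_d.
Hypothesis sigmaP : signature e sigma.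
Local Notation vfun := {ffun V -> 'cV[K]_d}.
Local Notation L := (conn_laplacian e D sigma).
Local Notation energy := (rGamma e D sigma).

Lemma sqrt_sum_le (I : finType) (P : pred I) (a : I -> R) :
  (forall i, 0 <= a i) ->
  Num.sqrt (\sum_(i | P i) a i) <= \sum_(i | P i) Num.sqrt (a i).
Proof.
move=> a0; suff [] : 0 <= \sum_(i | P i) a i /\
  Num.sqrt (\sum_(i | P i) a i) <= \sum_(i | P i) Num.sqrt (a i) by [].
elim/big_rec2: _ => [|i s t _ [t0 IH]]; first by rewrite sqrtr0.
split; first by rewrite addr_ge0.
apply: le_trans (lerD (lexx _) IH).
rewrite -[leRHS]ger0_norm ?addr_ge0 ?sqrtr_ge0 // -sqrtr_sqr ler_wsqrtr //.
rewrite sqrrD !sqr_sqrtr // lerD2r lerDl mulrn_wge0 // mulr_ge0 ?sqrtr_ge0 //.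
Qed.

Lemma enormN (v : 'cV[K]_d) : enorm (- v) = enorm v.
Proof.
by rewrite !enormE -sub0r dotBl dot0l dotBr dot0r !sub0r opprK.
Qed.

Definition edge_diff (f : vfun) (p : V * V) : R :=
  enorm (sigma p.1 p.2 *m f p.2 - f p.1).

(** Multiply by the isometry sigma_xy, the inverse of sigma_yx. *)
Lemma edge_diffC f x y : e x y -> edge_diff f (y, x) = edge_diff f (x, y).
Proof.
move=> exy; have [gxy yx] := sigmaP exy.
rewrite /edge_diff /= yx in_group_inv // -[RHS]enormN opprB !enormE.
congr Num.sqrt; rewrite -[LHS](dot_in_group _ _ gxy) mulmxBr mulmxA.
by rewrite in_group_mulmxV // mul1mx.
Qed.

Lemma sum_sqrt_energy_le f :
  \sum_x Num.sqrt (energy f f x)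
  <= (Num.sqrt (2 * D%:R))^-1 * \sum_(p | e p.1 p.2) edge_diff f p.
Proof.
rewrite -(pair_big_dep xpredT e (fun x y => edge_diff f (x, y))) mulr_sumr.
apply: ler_sum => x _; rewrite (rGammaE D sigmaP).
have c0 : 0 <= 2 * D%:R :> R by rewrite mulr_ge0.
have cV0 : 0 <= (2 * D%:R)^-1 :> R by rewrite invr_ge0.
rewrite (sqrtrM _ cV0) (sqrtrV c0).
rewrite ler_wpM2l ?invr_ge0 ?sqrtr_ge0 //.
apply: le_trans (sqrt_sum_le _ _) _ => [y|]; first exact: dot_ge0.
by apply: ler_sum => y _; rewrite /edge_diff enormE.
Qed.

Section Cut.
Variables (S : {set V}) (tau : V -> 'M[K]_d).
Hypothesis tauP : forall x, x \in S -> in_group (tau x).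

(** Its gradient has the two sources that phi counts: inside S the failure of
    tau to be parallel, and the cut along the boundary of S. *)
Definition cut_column (j : 'I_d) : vfun :=
  [ffun x => if x \in S then col j (tau x) else 0].

Lemma cdot_col (A : 'M[K]_d) i j :
  in_group A -> cdot (col i A) (col j A) = (i == j)%:R.
Proof.
move=> gA; have := congr1 (fun B : matrix _ _ _ => B j i) (in_group_mulVmx gA).
rewrite !mxE eq_sym => <-; rewrite cdotE; apply: eq_bigr => l _.
by rewrite !mxE mulrC.
Qed.

Lemma enorm_col (A : 'M[K]_d) j : in_group A -> enorm (col j A) = 1.
Proof.
by move=> gA; rewrite enormE /dot cdot_col // eqxx -(rmorph1 rc) re_real sqrtr1.
Qed.

Lemma dot_cut_column_le1 j x : dot (cut_column j x) (cut_column j x) <= 1.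
Proof.
rewrite ffunE; case: ifP => [xS|_]; last by rewrite dot0l ler01.
by rewrite /dot cdot_col ?tauP // eqxx -(rmorph1 rc) re_real.
Qed.

Lemma hdot_cut_column i j :
  hdot (cut_column i) (cut_column j) = (i == j)%:R * #|S|%:R.
Proof.
transitivity (\sum_(x in S) (i == j)%:R : K); last first.
  by rewrite sumr_const mulr_natr.
rewrite [RHS]big_mkcond; apply: eq_bigr => x _.
rewrite /pairing -/(cdot _ _) !ffunE; case: ifP => xS; last by rewrite cdot0l.
by rewrite cdot_col ?tauP.
Qed.

Lemma sum_edge_diff_inside p : p.1 \in S -> p.2 \in S ->
  \sum_j edge_diff (cut_column j) p
  = d%:R * norm21 (sigma p.1 p.2 *m tau p.2 - tau p.1).
Proof.
move=> p1 p2; rewrite mulVKf ?pnatr_eq0 -?lt0n //; apply: eq_bigr => j _.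
by rewrite /edge_diff !ffunE p1 p2 linearB /= !colE mulmxA.
Qed.

Lemma sum_edge_diff_boundary p : p \in boundary e S ->
  \sum_j edge_diff (cut_column j) p = d%:R.
Proof.
rewrite inE => /and3P[p1 /negPf p2 _].
rewrite (eq_bigr (fun=> 1)) ?sumr_const ?card_ord // => j _.
by rewrite /edge_diff !ffunE p1 p2 mulmx0 sub0r enormN enorm_col ?tauP.
Qed.

Definition swap_pair (p : V * V) : V * V := (p.2, p.1).

Lemma swap_pairK : involutive swap_pair.
Proof. by case. Qed.

(** Each edge occurs in both of its orientations.  Inside S the differences of
    the columns are those of the frustration index; across the boundary of S
    each of the d columns jumps by a unit vector. *)
Lemma sum_edge_diff :
  \sum_j \sum_(p | e p.1 p.2) edge_diff (cut_column j) p
  = 2 * d%:R * (frustration_of e sigma S tau + #|boundary e S|%:R).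
Proof.
pose b p := \sum_j edge_diff (cut_column j) p.
have bC p : e p.1 p.2 -> b (swap_pair p) = b p.
  by case: p => x y /= exy; apply: eq_bigr => j _; exact: edge_diffC.
have reswap (P : pred (V * V)) :
    \sum_(p | e p.1 p.2 && P p) b p
    = \sum_(p | e p.1 p.2 && P (swap_pair p)) b p.
  rewrite (reindex_inj (inv_inj swap_pairK)) /=.
  by apply: eq_big => [p|p /andP[ep _]]; rewrite /= ?bC // 1?e_sym.
rewrite exchange_big /= mulrDr.
rewrite (bigID (fun p : V * V => (p.1 \in S) && (p.2 \in S))) /=; congr (_ + _).
  rewrite (bigID (fun p : V * V => (enum_rank p.1 < enum_rank p.2)%N)) /=.
  set lhs := \sum_(p | _) _.
  have lhsE : lhs = d%:R * frustration_of e sigma S tau.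
    rewrite mulr_sumr; apply: eq_big => [p|p /andP[/andP[ep /andP[p1 p2]] _]].
      by case: (e _ _); case: (p.1 \in S); case: (p.2 \in S).
    exact: sum_edge_diff_inside.
  rewrite -mulrA -lhsE mulr_natl mulr2n; congr (_ + _).
  under eq_bigl do rewrite -andbA.
  rewrite reswap; apply: eq_bigl => -[x y] /=; rewrite -andbA.
  case exy: (e x y) => //=; case: (x \in S); case: (y \in S) => //=.
  rewrite -leqNgt leq_eqVlt; case: eqP => //= xy.
  by move: exy; rewrite (enum_rank_inj (val_inj xy)) e_irr.
rewrite (bigID (fun p : V * V => p.1 \in S)) /=.
set lhs := \sum_(p | _) _.
have lhsE : lhs = d%:R * #|boundary e S|%:R.
  transitivity (\sum_(p in boundary e S) d%:R : R); last first.
    by rewrite sumr_const mulr_natr.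
  apply: eq_big => [p|p /andP[/andP[ep p12] p1]].
    by rewrite inE; case: (e _ _); do 2?case: (_ \in _).
  apply: sum_edge_diff_boundary; rewrite inE ep p1.
  by move: p12; rewrite p1 /= => ->.
rewrite -mulrA -lhsE mulr_natl mulr2n; congr (_ + _).
rewrite (bigID (fun p : V * V => p.2 \in S)) /= [X in _ + X]big1 ?addr0.
  rewrite /lhs; under eq_bigl do rewrite -!andbA.
  under [RHS]eq_bigl do rewrite -!andbA.
  rewrite reswap; apply: eq_bigl => -[x y] /=.
  by case: (e x y); case: (x \in S); case: (y \in S).
move=> p /andP[/andP[_ /negPf p1] /negPf p2]; apply: big1 => j _.
by rewrite /edge_diff !ffunE p1 p2 mulmx0 subrr enormE dot0l sqrtr0.
Qed.

Lemma sum_sqrt_energy_cut :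
  \sum_j \sum_x Num.sqrt (energy (cut_column j) (cut_column j) x)
  <= (Num.sqrt (2 * D%:R))^-1
     * (2 * d%:R * (frustration_of e sigma S tau + #|boundary e S|%:R)).
Proof.
rewrite -sum_edge_diff mulr_sumr; apply: ler_sum => j _.
exact: sum_sqrt_energy_le.
Qed.

End Cut.

Lemma hdotZ a (f g : vfun) :
  hdot (rc a *: f) (rc a *: g) = rc (a ^+ 2) * hdot f g.
Proof.
rewrite mulr_sumr; apply: eq_bigr => x _; rewrite /pairing -!/(cdot _ _).
have E (h : vfun) : (rc a *: h) x = rc a *: h x by rewrite ffunE.
by rewrite !E cdotZl cdotZr field_conj_real mulrA -rmorphM expr2.
Qed.

Lemma euler_stepZ a (t : R) f g : euler_step e D sigma t f g ->
  euler_step e D sigma t (rc a *: f) (rc a *: g).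
Proof.
move=> ->; rewrite /euler_step scalerBr; congr (_ - _).
have -> : L (rc a *: g) = rc a *: L g by rewrite linearZ.
by rewrite !scalerA mulrC.
Qed.

Hypothesis curv : CD e D sigma 0.

Lemma euler_flow_ex (t : R) f : 0 <= t ->
  exists F : nat -> vfun,
    F 0 = f /\ forall n, euler_step e D sigma t (F n) (F n.+1).
Proof.
move=> t0; have [J JP] := choice (fun g => euler_step_ex D sigmaP g t0).
by exists (fun n => iter n J f); split=> // n; exact: JP.
Qed.

(** The k * d test functions, normalised, form an orthonormal family.  The flow
    moves them little, because their gradients are small; by Ky Fan's inequality
    it must move them at least by the contraction belonging to
    lambda_(k * d). *)
Lemma cheeger_flow_bound (k : nat) (S : 'I_k -> {set V})
    (tau : 'I_k -> V -> 'M[K]_d) (h t : R) (n : nat) :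
  (0 < k)%N -> admissible S ->
  (forall i x, x \in S i -> in_group (tau i x)) ->
  (forall i, frustration_of e sigma (S i) (tau i) + #|boundary e (S i)|%:R
             <= h * (D%:R * #|S i|%:R)) ->
  0 < t ->
  1 - (1 + t * lambda e D sigma (k * d)) ^- n.+1
  <= (k * d)%:R * (t * Num.sqrt 2 + Num.sqrt (2 * t * n%:R))
     * (Num.sqrt (2 * D%:R) * h).
Proof.
move=> k0 [S0 Sdisj] tauP hS t_gt0; have t0 := ltW t_gt0.
pose f (q : 'I_k * 'I_d) := cut_column (S q.1) (tau q.1) q.2.
have [F FP] := choice (fun q => euler_flow_ex (f q) t0).
pose s (q : 'I_k * 'I_d) : R := (Num.sqrt #|S q.1|%:R)^-1.
have cS i : 0 < #|S i|%:R :> R by rewrite ltr0n.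
have s2 q : s q ^+ 2 = #|S q.1|%:R^-1 by rewrite exprVn sqr_sqrtr // ltW.
pose G q m := rc (s q) *: F q m.
have card_kd : #|{: 'I_k * 'I_d}| = (k * d)%N by rewrite card_prod !card_ord.
have G0 q q' : hdot (G q 0%N) (G q' 0%N) = (q == q')%:R.
  rewrite /G !(proj1 (FP _)); case: q q' => i j [i' j'].
  rewrite xpair_eqE; have [<-|ii'] := eqVneq i i'.
    rewrite /s /= hdotZ /f /= hdot_cut_column; last exact: tauP.
    rewrite -[X in rc X]/(s (i, j) ^+ 2) s2 /= mulrCA fmorphV rmorph_nat.
    by rewrite mulVf ?mulr1 // pnatr_eq0 -lt0n.
  rewrite /hdot big1 // => x _; rewrite /pairing -/(cdot _ _).
  rewrite ffunE [X in cdot _ X]ffunE !ffunE /=.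
  case: ifP => [xi|_]; last by rewrite scaler0 cdot0l.
  case: ifP => [xi'|_]; last by rewrite scaler0 cdot0r.
  by have /pred0P/(_ x) := Sdisj _ _ ii'; rewrite /= xi xi'.
have Gstep q m : euler_step e D sigma t (G q m) (G q m.+1).
  by apply: euler_stepZ; apply: (proj2 (FP q)).
have kd0 : (0 < #|{: 'I_k * 'I_d}|)%N by rewrite card_kd muln_gt0 k0.
have := flow_trace e_sym sigmaP n.+1 t0 kd0 G0 Gstep; rewrite card_kd.
set q := _ ^- _ => trace.
pose loss q' :=
  re (hdot (G q' 0%N) (G q' 0%N)) - re (hdot (G q' 0%N) (G q' n.+1)).
have GG : 1 - q <= \sum_q' loss q'.
  rewrite sumrB; under eq_bigr do rewrite G0 eqxx -(rmorph1 rc) re_real.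
  rewrite sumr_const card_kd; lra.
apply: le_trans GG _.
set C := t * _ + _.
have C0 : 0 <= C by rewrite addr_ge0 ?mulr_ge0 ?sqrtr_ge0.
have -> : \sum_q' loss q' = \sum_i \sum_j loss (i, j).
  by rewrite pair_bigA; apply: eq_bigr => -[].
rewrite {}/loss; have bound i : \sum_j (re (hdot (G (i, j) 0%N) (G (i, j) 0%N))
                        - re (hdot (G (i, j) 0%N) (G (i, j) n.+1)))
    <= C * d%:R * (Num.sqrt (2 * D%:R) * h).
  have step j : re (hdot (G (i, j) 0%N) (G (i, j) 0%N))
                  - re (hdot (G (i, j) 0%N) (G (i, j) n.+1))
      <= #|S i|%:R^-1 * (C * \sum_x Num.sqrt (energy (f (i, j)) (f (i, j)) x)).
    rewrite !hdotZ !reZ -mulrBr s2 /= ler_wpM2l ?invr_ge0 //.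
    rewrite -raddfB /=; have [F0 Fs] := FP (i, j).
    have F01 x : dot (F (i, j) 0%N x) (F (i, j) 0%N x) <= 1.
      by rewrite F0; apply: dot_cut_column_le1; exact: tauP.
    by rewrite -[in X in _ <= X]F0; apply: flow_displacement.
  apply: le_trans (ler_sum _ (fun j _ => step j)) _.
  rewrite -!mulr_sumr mulrC ler_pdivrMr // -!mulrA ler_wpM2l //.
  apply: le_trans (sum_sqrt_energy_cut (tauP i)) _.
  have r0 : 0 < Num.sqrt (2 * D%:R) :> R by rewrite sqrtr_gt0 mulr_gt0 ?ltr0n.
  rewrite mulrC ler_pdivrMr //.
  have := sqr_sqrtr (mulr_ge0 (ler0n R 2) (ler0n R D)).
  rewrite expr2; set r := Num.sqrt (2 * D%:R) in r0 * => rr.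
  rewrite (_ : d%:R * _ * _ = d%:R * (2 * D%:R) * h * #|S i|%:R); last first.
    by rewrite -rr; ring.
  rewrite (_ : _ * h * _ = 2 * d%:R * (h * (D%:R * #|S i|%:R))); last by ring.
  by rewrite ler_wpM2l // mulr_ge0.
apply: le_trans (ler_sum _ (fun i _ => bound i)) _.
rewrite sumr_const card_ord -mulr_natl natrM le_eqVlt; apply/orP; left.
by apply/eqP; ring.
Qed.

End TestFunctions.

(** * Passage to the limit and the Buser inequality *)

(** As n grows, (1 + a / n) ^- n tends to exp (- a), which the hypothesis then
    bounds below by 1 / 2.  The estimate of the powers is
    1 / (1 + x) = 1 - x / (1 + x) <= exp (- x / (1 + x)). *)
Lemma euler_limit (R : realType) (a c : R) : 0 <= a -> 0 <= c ->
  (forall n, 1 - (1 + a / n.+1%:R) ^- n.+1 <= 2^-1 + c / n.+1%:R) ->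
  a <= ln 2.
Proof.
move=> a0 c0 ac; rewrite leNgt; apply/negP => lna.
(* Strictly between ln 2 and a, to leave room for the two error terms. *)
pose b := (a + ln 2) / 2.
have ba : b < a by rewrite /b; lra.
have lnb : ln 2 < b by rewrite /b; lra.
have b0 : 0 <= b by apply: le_trans (ltW lnb); rewrite ln_ge0 // ler1n.
have eb : 0 < 2^-1 - expR (- b).
  rewrite subr_gt0 expRN ltf_pV2 ?posrE ?expR_gt0 //.
  by rewrite -[X in X < _]lnK ?posrE // ltr_expR.
(* Large enough for the exponent and for the error term c / n. *)
pose n := maxn (Num.truncn (a * b / (a - b)))
               (Num.truncn (c / (2^-1 - expR (- b)))).
have N0 : 0 < n.+1%:R :> R by rewrite ltr0n.
have nle m : (m <= n)%N -> m.+1%:R <= n.+1%:R :> R by rewrite ler_nat ltnS.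
have n1 : a * b <= n.+1%:R * (a - b).
  rewrite -ler_pdivrMr ?subr_gt0 //; apply/ltW/(lt_le_trans (truncnS_gt _)).
  exact/nle/leq_maxl.
have n2 : c < n.+1%:R * (2^-1 - expR (- b)).
  rewrite -ltr_pdivrMr //; apply/(lt_le_trans (truncnS_gt _)).
  exact/nle/leq_maxr.
have := ac n; rewrite leNgt => /negP; apply.
move NE : (n.+1%:R : R) => N in n1 n2 N0 *.
have Na : 0 < N + a by rewrite ltr_wpDr.
have step : (1 + a / N)^-1 <= expR (- (a / (N + a))).
  have N1 : 1 + a / N != 0 by rewrite gt_eqF // ltr_pwDl // divr_ge0 // ltW.
  rewrite [leLHS](_ : _ = 1 + - (a / (N + a))) ?expR_ge1Dx //.
  by field; rewrite !gt_eqF.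
have : (1 + a / N) ^- n.+1 <= expR (- b).
  rewrite -exprVn; apply: le_trans (_ : expR (- (a / (N + a))) ^+ n.+1 <= _).
    rewrite lerXn2r ?nnegrE ?expR_ge0 // invr_ge0 addr_ge0 //.
    by rewrite divr_ge0 // (ltW N0).
  rewrite -expRM_natl ler_expR mulrN lerN2 mulrA ler_pdivlMr //.
  rewrite NE; lra.
have : c / N < 2^-1 - expR (- b) by rewrite ltr_pdivrMr // mulrC.
rewrite ltrBrDl => cN powE; rewrite ltrBrDr -ltrBrDl.
apply: le_lt_trans powE _; lra.
Qed.

Section Buser.
Variables (R : realType) (H : group_family) (d : nat).
Variables (V : finType) (e : rel V) (D : nat).
Hypothesis (d_gt0 : (0 < d)%N) (D_gt0 : (0 < D)%N).
Hypothesis (e_sym : symmetric e) (e_irr : irreflexive e) (e_reg : regular e D).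
Variable sigma : V -> V -> 'M[base_field R H]_d.
Hypothesis sigmaP : signature e sigma.
Variable k : nat.
Hypothesis (k_gt0 : (0 < k)%N) (kV : (k <= #|V|)%N).

Lemma admissible_ex : exists S : 'I_k -> {set V}, admissible S.
Proof.
exists (fun i => [set enum_val (widen_ord kV i)]); split=> [i|i j ij].
  by rewrite cards1.
rewrite disjoints1 inE (inj_eq enum_val_inj); apply: contra ij => /eqP ij.
by apply/eqP/val_inj; exact: (congr1 val ij).
Qed.

(** Near-minimisers of the two nested infima.  They suffice, because the final
    bound is continuous in h. *)
Lemma cheeger_approx (h : R) : cheeger e D sigma k < h ->
  exists (S : 'I_k -> {set V}) (tau : 'I_k -> V -> 'M[base_field R H]_d),
  [/\ admissible S, forall i x, x \in S i -> in_group (tau i x) &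
      forall i, frustration_of e sigma (S i) (tau i) + #|boundary e (S i)|%:R
                <= h * (D%:R * #|S i|%:R)].
Proof.
move=> /inf_lt [|_ [S adS <-]].
  by have [S adS] := admissible_ex; eexists; exists S.
move=> hS; have hi i : phi e D sigma (S i) < h.
  exact: le_lt_trans (le_bigmax _ _ i) hS.
have tauP i : exists tau : V -> 'M[base_field R H]_d,
    (forall x, x \in S i -> in_group (tau x)) /\
    frustration_of e sigma (S i) tau + #|boundary e (S i)|%:R
    <= h * (D%:R * #|S i|%:R).
  have := hi i; rewrite /phi ltr_pdivrMr; last first.
    by rewrite mulr_gt0 ?ltr0n //; exact: (proj1 adS).
  rewrite -ltrBrDr => /inf_lt[|_ [tau tauS <-] tauh].
    exists (frustration_of e sigma (S i) (fun=> 1%:M)).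
    exists (fun=> 1%:M) => // x _ /=.
    exact: in_group1.
  by exists tau; split=> //; rewrite -lerBrDr ltW.
have [tau tauS] := choice tauP.
by exists S, tau; split=> // i; case: (tauS i).
Qed.

Lemma cheeger_ge0 : 0 <= cheeger e D sigma k.
Proof.
apply: lb_le_inf => [|_ [S _ <-]].
  by have [S adS] := admissible_ex; eexists; exists S.
exact: bigmax_ge_id.
Qed.

Hypothesis curv : CD e D sigma 0.

(** Take n + 1 steps of length s / (n + 1) and let n grow: the bound of the flow
    becomes 1 - exp (- s lambda) <= 1 / 2. *)
Lemma lambda_le_sqr (h : R) : 0 < h -> cheeger e D sigma k < h ->
  lambda e D sigma (k * d)
  <= 16 * D%:R * (k * d)%:R ^+ 2 * ln (2 * (k * d)%:R) * h ^+ 2.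
Proof.
move=> h0 /cheeger_approx[S [tau [adS tauS hS]]].
set m : R := (k * d)%:R; set lam := lambda _ _ _ _.
have m1 : 1 <= m by rewrite ler1n muln_gt0 k_gt0.
have m0 : 0 < m := lt_le_trans ltr01 m1.
have D0 : 0 < D%:R :> R by rewrite ltr0n.
(* The time at which the displacement bound equals 1 / 2. *)
pose s := (16 * D%:R * m ^+ 2 * h ^+ 2)^-1.
have s0 : 0 < s by rewrite invr_gt0 !mulr_gt0 // exprn_gt0.
have sE : m * Num.sqrt (2 * s) * (Num.sqrt (2 * D%:R) * h) = 2^-1.
  rewrite mulrA -[m * _ * _]mulrA -sqrtrM ?mulr_ge0 ?ltW //.
  have -> : 2 * s * (2 * D%:R) = ((2 * m * h)^-1) ^+ 2.
    by rewrite /s /m natrM; field; rewrite !gt_eqF ?ltr0n.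
  rewrite sqrtr_sqr ger0_norm ?invr_ge0 ?mulr_ge0 ?ltW //.
  by rewrite /m natrM; field; rewrite !gt_eqF ?ltr0n.
suff sl : s * lam <= ln 2.
  have : lam <= 16 * D%:R * m ^+ 2 * h ^+ 2 * ln 2.
    rewrite -ler_pdivrMl // -?/s //.
    by rewrite !mulr_gt0 // exprn_gt0.
  move=> /le_trans; apply.
  rewrite [leRHS]mulrAC ler_wpM2l ?mulr_ge0 ?exprn_ge0 ?(ltW m0) ?(ltW h0) //.
  by rewrite ler_ln ?posrE ?mulr_gt0 // ler_pMr.
have lam0 : 0 <= lam by apply: lambda_ge0.
apply: (@euler_limit _ _ (s * Num.sqrt 2 * m * (Num.sqrt (2 * D%:R) * h))).
- by rewrite mulr_ge0 // ltW.
- by rewrite !mulr_ge0 ?sqrtr_ge0 // ltW.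
move=> n; set N : R := n.+1%:R.
have N0 : 0 < N by rewrite ltr0n.
have t0 : 0 < s / N by rewrite divr_gt0.
have := cheeger_flow_bound d_gt0 D_gt0 e_sym e_irr e_reg sigmaP curv n k_gt0
  adS tauS hS t0.
rewrite -/lam -/m mulrAC => /le_trans; apply.
rewrite mulrDr mulrDl addrC lerD //.
  rewrite -sE ler_wpM2r ?mulr_ge0 ?sqrtr_ge0 ?(ltW h0) //.
  rewrite ler_wpM2l ?(ltW m0) // ler_wsqrtr //.
  rewrite -mulrA ler_wpM2l // mulrAC ler_pdivrMr // ler_wpM2l ?(ltW s0) //.
  by rewrite ler_nat.
by rewrite le_eqVlt; apply/orP; left; apply/eqP; field; rewrite gt_eqF.
Qed.

End Buser.

Theorem theorem1p1 (R : realType) (H : group_family) (D d : nat)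
    (hD : (1 <= D)%N) (hd : (1 <= d)%N)
    (V : finType) (e : rel V) (he : simple_graph e) (hreg : regular e D)
    (sigma : V -> V -> 'M[base_field R H]_d) (hsigma : signature e sigma)
    (hCD : CD e D sigma 0) (k : nat) (hk1 : (1 <= k)%N) (hkN : (k <= #|V|)%N) :
  lambda e D sigma (k * d)
    <= 16 * D%:R * (k * d)%:R ^+ 2 * ln (2 * (k * d)%:R)
       * cheeger e D sigma k ^+ 2.
Proof.
have [esym eirr] := he.
set c := 16 * _ * _ * _; set h := cheeger _ _ _ _; set lam := lambda _ _ _ _.
have h0 : 0 <= h by exact: cheeger_ge0.
have bound x : h < x -> lam <= c * x ^+ 2.
  by move=> hx; apply: lambda_le_sqr => //; exact: le_lt_trans h0 hx.
have m1 : 1 <= (k * d)%:R :> R by rewrite ler1n muln_gt0 hk1.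
have c0 : 0 <= c.
  rewrite !mulr_ge0 ?exprn_ge0 ?ln_ge0 // -[leLHS]mulr1.
  by rewrite ler_pM // ler1n.
apply/ler_addgt0Pr => eps eps0.
pose y := Num.min 1 (eps / (c * (2 * h + 1) + 1)).
have z0 : 0 < c * (2 * h + 1) + 1.
  by rewrite ltr_wpDl // mulr_ge0 // addr_ge0 // mulr_ge0.
have y0 : 0 < y by rewrite lt_min ltr01 divr_gt0.
have y1 : y <= 1 by rewrite ge_min lexx.
have yeps : y * (c * (2 * h + 1) + 1) <= eps.
  by rewrite -ler_pdivlMr // ge_min lexx orbT.
have hy : h < h + y by rewrite ltrDl.
apply: le_trans (bound _ hy) _.
have : c * (y * (1 - y)) >= 0 by rewrite mulr_ge0 // mulr_ge0 ?subr_ge0 // ltW.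
lra.
Qed.
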